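(* $U_{3,7}$ is an excluded minor for the class of quasi-graphic matroids, i.e., $U_{3,7}$ is not quasi-graphic but every proper minor of $U_{3,7}$ is quasi-graphic.
   Context: Graphs may have loops and parallel edges. For a graph $H$ and vertex $v$, $\mathrm{loops}_H(v)$ denotes the set of loops of $H$ at $v$. A graph $H$ is a framework for a matroid $N$ if (QG1) $E(H)=E(N)$; (QG2) $r_N(E(H'))\le |V(H')|$ for each component $H'$ of $H$; (QG3) for each vertex $v$ of $H$, $\mathrm{cl}_N(E(H-v))\subseteq E(H-v)\cup \mathrm{loops}_H(v)$; (QG4) for each circuit $C$ of $N$, the subgraph $H[C]$ has at most two components. A matroid is quasi-graphic if it has a framework. *)

(* Defs.v *)
From mathcomp Require Import all_boot.
Set Implicit Arguments.
Unset Strict Implicit.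
Unset Printing Implicit Defensive.

(* The ground set is a subset of an ambient finite type [T], so that a matroid
   and all its minors live over the same type. *)
Record matroid (T : finType) := Matroid {
  ground : {set T};
  indep : pred {set T};
  indep_ground : forall I : {set T}, indep I -> I \subset ground;
  indep0 : indep set0;
  indep_sub : forall I J : {set T}, I \subset J -> indep J -> indep I;
  indep_aug : forall I J : {set T}, indep I -> indep J -> #|I| < #|J| ->
    exists2 x, x \in J :\: I & indep (x |: I)
}.

Section MatroidTheory.
Variables (T : finType) (M : matroid T).
Implicit Types (I J X Y C D : {set T}).

Definition rank X : nat := \max_(I : {set T} | indep M I && (I \subset X)) #|I|.

Definition mclosure X : {set T} :=
  [set e in ground M | rank (e |: X) == rank X].

Definition circuit C : bool :=
  minset (fun D : {set T} => (D \subset ground M) && ~~ indep M D) C.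

Lemma rank_ge I X : indep M I -> I \subset X -> #|I| <= rank X.
Proof. by move=> iI sI; apply: (bigmax_sup I); rewrite ?iI ?sI. Qed.

Lemma rank_basis X : exists I, [/\ indep M I, I \subset X & #|I| = rank X].
Proof.
have [|I /andP[iI sI] eqI] := @eq_bigmax_cond _
    [pred I : {set T} | indep M I && (I \subset X)] (fun I => #|I|).
  by apply/card_gt0P; exists set0; rewrite inE indep0 sub0set.
by exists I.
Qed.

Lemma rank_setU X Y : rank (X :|: Y) <= #|X| + rank Y.
Proof.
have [I [iI sI <-]] := rank_basis (X :|: Y).
rewrite -(cardsID X I) leq_add ?subset_leq_card ?subsetIr //.
apply: rank_ge; first exact: indep_sub (subsetDl _ _) iI.
by rewrite subDset.
Qed.

Lemma delete_indep_ground D I :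
  indep M I && [disjoint I & D] -> I \subset ground M :\: D.
Proof. by case/andP=> /indep_ground sI dI; rewrite subsetD sI. Qed.

Lemma delete_indep0 D : indep M set0 && [disjoint set0 & D].
Proof. by rewrite indep0 -setI_eq0 set0I eqxx. Qed.

Lemma delete_indep_sub D I J : I \subset J ->
  indep M J && [disjoint J & D] -> indep M I && [disjoint I & D].
Proof.
by move=> sIJ /andP[iJ dJ]; rewrite (indep_sub sIJ iJ) (disjointWl sIJ dJ).
Qed.

Lemma delete_indep_aug D I J :
  indep M I && [disjoint I & D] -> indep M J && [disjoint J & D] ->
  #|I| < #|J| ->
  exists2 x, x \in J :\: I & indep M (x |: I) && [disjoint x |: I & D].
Proof.
move=> /andP[iI dI] /andP[iJ dJ] ltIJ.
have [x xJI ixI] := indep_aug iI iJ ltIJ; exists x => //.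
have /setDP[xJ _] := xJI.
by rewrite ixI disjoints_subset subUset sub1set in_setC (disjointFr dJ xJ)
           -disjoints_subset.
Qed.

Definition delete D : matroid T :=
  Matroid (@delete_indep_ground D) (delete_indep0 D)
    (@delete_indep_sub D) (@delete_indep_aug D).

(* [I] is independent in [M / C] iff its rank in [M / C], which is
   [rank (I :|: C) - rank C], equals [#|I|]. *)
Definition contract_indep C : pred {set T} := fun I =>
  (I \subset ground M :\: C) && (rank (I :|: C) == #|I| + rank C).

Lemma contract_indep_ground C I :
  contract_indep C I -> I \subset ground M :\: C.
Proof. by case/andP. Qed.

Lemma contract_indep0 C : contract_indep C set0.
Proof. by rewrite /contract_indep sub0set set0U cards0 add0n eqxx. Qed.

Lemma contract_indep_sub C I J :
  I \subset J -> contract_indep C J -> contract_indep C I.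
Proof.
move=> sIJ /andP[sJ /eqP rJ].
rewrite /contract_indep (subset_trans sIJ sJ) eqn_leq rank_setU /=.
have := rank_setU (J :\: I) (I :|: C).
rewrite setUA [_ :\: _ :|: _]setUC -[I in I :|: _ :\: _](setIidPr sIJ) setID rJ.
by rewrite -(cardsID I J) (setIidPr sIJ) [#|I| + _]addnC -addnA leq_add2l.
Qed.

Lemma contract_indep_aug C I J :
  contract_indep C I -> contract_indep C J -> #|I| < #|J| ->
  exists2 x, x \in J :\: I & contract_indep C (x |: I).
Proof.
move=> /andP[sI /eqP rI] /andP[sJ /eqP rJ] ltIJ.
have [A [iA sA cA]] := rank_basis (I :|: C).
have [B [iB sB cB]] := rank_basis (J :|: C).
have [|x /setDP[xB xA] ixA] := indep_aug iA iB.
  by rewrite cA cB rI rJ ltn_add2r.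
have xIC : x \notin I :|: C.
  apply/negP => xIC; have: #|x |: A| <= rank (I :|: C).
    by apply: rank_ge => //; rewrite subUset sub1set xIC.
  by rewrite cardsU1 xA cA ltnn.
have /norP[xI xC] : ~~ ((x \in I) || (x \in C)) by rewrite -in_setU.
have xJ : x \in J.
  by have := subsetP sB x xB; rewrite in_setU (negPf xC) orbF.
exists x; first by rewrite in_setD xI.
rewrite /contract_indep subUset sub1set (subsetP sJ x xJ) sI /=.
rewrite eqn_leq rank_setU /= cardsU1 xI -addnA -rI -cA.
have -> : true + #|A| = #|x |: A| by rewrite cardsU1 xA.
by apply: rank_ge => //; rewrite -setUA setUS.
Qed.

Definition contract C : matroid T :=
  Matroid (@contract_indep_ground C) (contract_indep0 C)
    (@contract_indep_sub C) (@contract_indep_aug C).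

End MatroidTheory.

Definition same_matroid (T : finType) (M N : matroid T) : Prop :=
  ground M = ground N /\ indep M =1 indep N.

Definition proper_minor (T : finType) (N M : matroid T) : Prop :=
  exists C D : {set T},
    [/\ C :|: D \subset ground M, [disjoint C & D], C :|: D != set0
      & same_matroid N (delete (contract M C) D)].

Definition excluded_minor (P : forall T : finType, matroid T -> Prop)
    (T : finType) (M : matroid T) : Prop :=
  ~ P T M /\ forall N : matroid T, proper_minor N M -> P T N.

Section Uniform.
Variables r n : nat.
Implicit Types I J : {set 'I_n}.

Lemma uniform_indep_ground I : #|I| <= r -> I \subset [set: 'I_n].
Proof. by rewrite subsetT. Qed.

Lemma uniform_indep0 : #|(set0 : {set 'I_n})| <= r.
Proof. by rewrite cards0. Qed.

Lemma uniform_indep_sub I J : I \subset J -> #|J| <= r -> #|I| <= r.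
Proof. by move/subset_leq_card; apply: leq_trans. Qed.

Lemma uniform_indep_aug I J : #|I| <= r -> #|J| <= r -> #|I| < #|J| ->
  exists2 x, x \in J :\: I & #|x |: I| <= r.
Proof.
move=> _ cJ ltIJ; have [x xJI] : exists x, x \in J :\: I.
  apply/card_gt0P; rewrite cardsD subn_gt0.
  by rewrite (leq_ltn_trans _ ltIJ) // subset_leq_card // subsetIr.
exists x => //; have /setDP[_ xI] := xJI.
by rewrite cardsU1 xI (leq_trans ltIJ cJ).
Qed.

Definition uniform : matroid 'I_n :=
  @Matroid _ [set: 'I_n] (fun I => #|I| <= r) uniform_indep_ground
    uniform_indep0 uniform_indep_sub uniform_indep_aug.
End Uniform.

(* Finite graphs with loops and parallel edges: vertices are taken from [V],
   edges from [T]; [ends e] has one element when [e] is a loop and two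
   otherwise. The value of [ends] outside [eset] is irrelevant. *)
Record graph (V T : finType) := Graph {
  vset : {set V};
  eset : {set T};
  ends : T -> {set V};
  ends_vset : forall e, e \in eset -> ends e \subset vset;
  ends_card : forall e, e \in eset -> 0 < #|ends e| <= 2
}.

Section GraphTheory.
Variables (V T : finType) (H : graph V T).

Definition loops (v : V) : {set T} := [set e in eset H | ends H e == [set v]].

Definition adj : rel V :=
  fun u v => [exists e in eset H, ends H e == [set u; v]].

(* A component is represented by its vertex set [K]; the component itself is
   [induced K] below. *)
Definition components : {set {set V}} :=
  equivalence_partition (connect adj) (vset H).

Section Induced.
Variable K : {set V}.
Let vK := vset H :&: K.
Let eK := [set e in eset H | ends H e \subset K].

Lemma induced_ends_vset e : e \in eK -> ends H e \subset vK.
Proof. by rewrite inE subsetI => /andP[eH ->]; rewrite ends_vset. Qed.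

Lemma induced_ends_card e : e \in eK -> 0 < #|ends H e| <= 2.
Proof. by rewrite inE => /andP[/ends_card]. Qed.

Definition induced : graph V T :=
  Graph induced_ends_vset induced_ends_card.
End Induced.

Definition delete_vertex (v : V) : graph V T := induced [set~ v].

Section EdgeInduced.
Variable C : {set T}.
Let eC := eset H :&: C.
Let vC := \bigcup_(e in eC) ends H e.

Lemma edge_induced_ends_vset e : e \in eC -> ends H e \subset vC.
Proof. by move=> eC_e; apply: bigcup_sup. Qed.

Lemma edge_induced_ends_card e : e \in eC -> 0 < #|ends H e| <= 2.
Proof. by case/setIP=> /ends_card. Qed.

Definition edge_induced : graph V T :=
  Graph edge_induced_ends_vset edge_induced_ends_card.
End EdgeInduced.

End GraphTheory.

Record framework (V T : finType) (H : graph V T) (N : matroid T) : Prop :=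
  Framework {
    QG1 : eset H = ground N;
    QG2 : forall K, K \in components H ->
      rank N (eset (induced H K)) <= #|vset (induced H K)|;
    QG3 : forall v, v \in vset H ->
      mclosure N (eset (delete_vertex H v))
        \subset eset (delete_vertex H v) :|: loops H v;
    QG4 : forall C, circuit N C -> #|components (edge_induced H C)| <= 2
  }.

Definition quasi_graphic (T : finType) (N : matroid T) : Prop :=
  exists (V : finType) (H : graph V T), framework H N.

(* Main.v *)
Require Import Defs.
From mathcomp Require Import all_boot.
From mathcomp Require Import zify.
Set Implicit Arguments.
Unset Strict Implicit.
Unset Printing Implicit Defensive.

(** In a rank-3 uniform matroid with at least 7 elements, (QG3) forces all but
    at most two edges of a framework to meet any given non-isolated vertex. A
    component with a non-loop edge thus has at least five edges, hence at least
    three vertices by (QG2); every edge avoids one of these three vertices, so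
    there are at most six edges. Otherwise all edges are loops, at distinct
    vertices by (QG2), and four of them violate (QG4).

    The proper minors are uniform of rank at most 2, or of rank 3 on at most six
    elements. Frameworks for them are given by bouquets of loops, by parallel
    edges, and by a triangle with each edge at most doubled. *)

(** Relative to [ground N] instead of the whole type, so that minors of a uniform matroid also
    qualify. *)
Definition uniform_on (T : finType) (N : matroid T) (r : nat) : Prop :=
  forall I : {set T}, indep N I = (I \subset ground N) && (#|I| <= r).

(** * Rank, closure, circuits and minors of uniform matroids *)

Section UniformOn.
Variables (T : finType) (N : matroid T) (r : nat).
Hypothesis uN : uniform_on N r.
Implicit Type X : {set T}.

Lemma uniform_on_rank X : X \subset ground N -> rank N X = minn r #|X|.
Proof.
move=> sX; apply/eqP; rewrite eqn_leq; apply/andP; split.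
  have [I [iI sI <-]] := rank_basis N X; move: iI; rewrite uN => /andP[_ cI].
  by rewrite leq_min cI subset_leq_card.
have [A [sA cA]] : exists A : {set T}, A \subset X /\ #|A| = minn r #|X|.
  have /card_geqP[s [us ss sX']] := geq_minr r #|X|.
  exists [set x in s]; split.
    by apply/subsetP => x; rewrite inE; apply: sX'.
  by rewrite cardsE (card_uniqP us).
by rewrite -cA; apply: rank_ge => //; rewrite uN (subset_trans sA sX) cA geq_minl.
Qed.

Lemma uniform_on_mclosure_small X :
  X \subset ground N -> #|X| < r -> mclosure N X \subset X.
Proof.
move=> sX ltX; apply/subsetP => e; rewrite inE => /andP[eN].
rewrite !uniform_on_rank ?subUset ?sub1set ?eN // cardsU1.
by case: (e \in X) => //=; lia.
Qed.

Lemma uniform_on_mclosure_large X :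
  X \subset ground N -> r <= #|X| -> mclosure N X = ground N.
Proof.
move=> sX leX; apply/setP => e; rewrite inE.
case eN: (e \in ground N) => //=.
by rewrite !uniform_on_rank ?subUset ?sub1set ?eN // cardsU1; lia.
Qed.

Lemma uniform_on_circuit X :
  X \subset ground N -> #|X| = r.+1 -> circuit N X.
Proof.
move=> sX cX; apply/minsetP; split; first by rewrite sX uN sX cX ltnn.
move=> Y /andP[sY]; rewrite uN sY /= -ltnNge => cY sYX.
by apply/eqP; rewrite eqEcard sYX cX.
Qed.

(** The condition [minn r (#|I| + #|C|) = #|I| + minn r #|C|] means exactly [#|I| <= r - #|C|];
    truncated subtraction covers the case where [C] is spanning. *)
Lemma uniform_on_contract_delete (C D : {set T}) : C \subset ground N ->
  uniform_on (delete (contract N C) D) (r - #|C|).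
Proof.
move=> sC I; rewrite /= /contract_indep !subsetD -!andbA.
case sI: (I \subset ground N) => //=.
case dI: [disjoint I & C] => //=.
rewrite !uniform_on_rank ?subUset ?sI // cardsU.
move: dI; rewrite -setI_eq0 => /eqP ->; rewrite cards0 subn0 andbC.
by congr (_ && _); lia.
Qed.

End UniformOn.

Lemma uniform_uniform_on r n : uniform_on (uniform r n) r.
Proof. by move=> I /=; rewrite subsetT. Qed.

(** * Connectivity and components of graphs *)

Section Components.
Variables (V T : finType) (H : graph V T).

Lemma adj_sym : symmetric (adj H).
Proof. by move=> u v; rewrite /adj setUC. Qed.

Lemma connect_adj_equiv : equivalence_rel (connect (adj H)).
Proof.
have cs := sym_connect_sym adj_sym.
move=> x y z; split; first exact: connect0.
by move=> xy; apply/idP/idP; apply: connect_trans; rewrite // cs.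
Qed.

Lemma ends_connect (e : T) (x y : V) : e \in eset H ->
  x \in ends H e -> y \in ends H e -> connect (adj H) x y.
Proof.
move=> eH xe ye; have [->|nxy] := eqVneq x y; first exact: connect0.
apply/connect1/existsP; exists e; rewrite eH eq_sym eqEcard cards2 nxy /=.
by rewrite subUset !sub1set xe ye; case/andP: (ends_card eH).
Qed.

(** Take the first edge of a path from [x] to [y] without repeated vertices. *)
Lemma connect_nonloop (x y : V) : connect (adj H) x y -> x != y ->
  exists e z, [/\ e \in eset H, x != z & ends H e = [set x; z]].
Proof.
case/connectP=> p0 /shortenP[[|z p] /= pp up _ ->]; first by rewrite eqxx.
case/andP: pp => /existsP[e /andP[eH /eqP ee]] _ _.
exists e, z; split=> //; case/andP: up.
by rewrite inE negb_or => /andP[].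
Qed.

Definition component (x : V) : {set V} :=
  [set y in vset H | connect (adj H) x y].

Lemma component_in (x : V) : x \in vset H -> component x \in components H.
Proof. by move=> xH; apply/imsetP; exists x. Qed.

Lemma component_induced_vset (x : V) :
  vset (induced H (component x)) = component x.
Proof.
by apply/setIidPr; apply/subsetP => y; rewrite inE => /andP[].
Qed.

Lemma component_edge (x : V) (e : T) : e \in eset H -> x \in ends H e ->
  e \in eset (induced H (component x)).
Proof.
move=> eH xe; rewrite inE eH; apply/subsetP => y ye; rewrite inE.
by rewrite (subsetP (ends_vset eH)) // (ends_connect eH).
Qed.

Lemma components_le1 :
  vset H = \bigcup_(e in eset H) ends H e ->
  {in eset H &, forall e f, ends H e :&: ends H f != set0} ->
  #|components H| <= 1.
Proof.
move=> vH meet; apply/card_le1_eqP => K L /imsetP[x xH ->] /imsetP[y yH ->].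
move: (xH) (yH); rewrite vH => /bigcupP[e eH xe] /bigcupP[f fH yf].
have [z /setIP[ze zf]] := set0Pn _ (meet e f eH fH).
have xy : connect (adj H) x y.
  exact: connect_trans (ends_connect eH xe ze) (ends_connect fH zf yf).
apply/setP => w; rewrite !inE.
by have [_ ->] := connect_adj_equiv x y w.
Qed.

End Components.

(** Pairwise meeting edges make every [H[C]] connected, which gives (QG4). In (QG3), fewer than [r]
    edges avoiding [v] form a closed set; if instead all edges at [v] are loops, the right-hand side
    is the whole ground set. *)
Lemma framework_uniform_on (V T : finType) (H : graph V T) (N : matroid T) r :
  uniform_on N r ->
  eset H = ground N -> vset H = setT ->
  {in eset H &, forall e f, ends H e :&: ends H f != set0} ->
  (forall K : {set V},
     minn r #|[set e in eset H | ends H e \subset K]| <= #|K|) ->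
  (forall v, #|[set e in eset H | v \notin ends H e]| < r
     \/ {in eset H, forall e, v \in ends H e -> ends H e = [set v]}) ->
  framework H N.
Proof.
move=> uN eN vT meet rkK clv; split=> //.
- move=> K _ /=; rewrite vT setTI.
  rewrite (uniform_on_rank uN) //.
  by apply/subsetP => e; rewrite inE eN => /andP[].
- move=> v _.
  have eHv : eset (delete_vertex H v) = [set e in eset H | v \notin ends H e].
    by apply/setP => e; rewrite !inE subsetC sub1set inE.
  have sHv : eset (delete_vertex H v) \subset ground N.
    by rewrite -eN; apply/subsetP => e; rewrite inE => /andP[].
  have [lt_r|lv] := clv v.
    apply: subset_trans (subsetUl _ _).
    by apply: (uniform_on_mclosure_small uN); rewrite // eHv.
  apply/subsetP => e; rewrite inE -eN => /andP[eH _].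
  rewrite eHv !inE eH /=; case ve: (v \in ends H e) => //=.
  by rewrite (lv e eH ve).
- move=> C _; apply: leq_trans (_ : 1 <= 2) => //.
  apply: components_le1 => // e f /setIP[eH _] /setIP[fH _]; exact: meet.
Qed.

(** * Explicit frameworks in ranks up to three *)

Section Frameworks.
Variables (T : finType) (N : matroid T).

Lemma uniform_on_le1_quasi_graphic r :
  r <= 1 -> uniform_on N r -> quasi_graphic N.
Proof.
move=> r1 uN.
(* A bouquet: every element is a loop at a single vertex. *)
have ev e : e \in ground N -> [set: unit] \subset [set: unit] by [].
have ec e : e \in ground N -> 0 < #|[set: unit]| <= 2 by rewrite cardsT card_unit.
exists unit, (Graph ev ec); apply: (@framework_uniform_on _ _ _ _ r) => //=.
- by move=> e f _ _; rewrite setIT; apply/set0Pn; exists tt.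
- move=> K; have [->|[[] ttK]] := set_0Vmem K.
    rewrite (_ : [set e in _ | _] = set0) ?cards0 ?minn0 //.
    by apply/setP => e; rewrite !inE subset0 -cards_eq0 cardsT card_unit andbF.
  by apply: leq_trans (geq_minl _ _) (leq_trans r1 _); apply/card_gt0P; exists tt.
- by case; right=> e _ _; apply/setP; case; rewrite !inE.
Qed.

Lemma uniform_on_2_quasi_graphic : uniform_on N 2 -> quasi_graphic N.
Proof.
move=> uN.
(* All elements are parallel edges on two vertices, so no edge avoids a vertex. *)
have ev e : e \in ground N -> [set: bool] \subset [set: bool] by [].
have ec e : e \in ground N -> 0 < #|[set: bool]| <= 2 by rewrite cardsT card_bool.
exists bool, (Graph ev ec); apply: (@framework_uniform_on _ _ _ _ 2) => //=.
- by move=> e f _ _; rewrite setIT; apply/set0Pn; exists true.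
- move=> K; case sK: ([set: bool] \subset K).
    by apply: leq_trans (geq_minl _ _) _; rewrite -card_bool -cardsT subset_leq_card.
  rewrite (_ : [set e in _ | _] = set0) ?cards0 ?minn0 //.
  by apply/setP => e; rewrite !inE andbF.
- move=> v; left; rewrite (_ : [set e in _ | _] = set0) ?cards0 //.
  by apply/setP => e; rewrite !inE andbF.
Qed.

Lemma balanced_coloring (E : {set T}) k : #|E| <= k.+1.*2 ->
  exists f : T -> 'I_k.+1, forall i, #|[set e in E | f e == i]| <= 2.
Proof.
(* Positions [2i] and [2i+1] of the enumeration receive color [i]. On [E] the halved index is at
   most [k], so [inord] keeps its value; colors outside [E] are irrelevant. *)
move=> cE; exists (fun e => inord (index e (enum E))./2) => i.
have [->|[x0 _]] := set_0Vmem E.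
  by rewrite (_ : [set e in _ | _] = set0) ?cards0 //; apply/setP => e; rewrite !inE.
pose s := enum E.
apply: (@leq_trans #|[set nth x0 s i.*2; nth x0 s i.*2.+1]|); last first.
  by rewrite cards2; case: (_ != _).
apply/subset_leq_card/subsetP => e; rewrite !inE => /andP[eE /eqP ei].
have es : e \in s by rewrite mem_enum.
have lts : index e s < k.+1.*2.
  by apply: leq_trans cE; rewrite cardE index_mem.
have {}ei : (index e s)./2 = i by rewrite -ei inordK ?ltn_half_double.
have [a|a] : index e s = i.*2 \/ index e s = i.*2.+1.
  by rewrite -ei -{1 3}(odd_double_half (index e s)); case: odd; [right|left].
  by rewrite -a nth_index // eqxx.
by rewrite -a nth_index // eqxx orbT.
Qed.

(* Each color class of size at most two is a pair of parallel edges of a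
   triangle, opposite to the vertex that names the color. *)
Lemma uniform_on_3_quasi_graphic :
  #|ground N| <= 6 -> uniform_on N 3 -> quasi_graphic N.
Proof.
move=> cN uN; have [f fP] := @balanced_coloring (ground N) 2 cN.
have cC (i : 'I_3) : #|[set~ i]| = 2 by rewrite cardsC1 card_ord.
have ev e : e \in ground N -> [set~ f e] \subset [set: 'I_3] by [].
have ec e : e \in ground N -> 0 < #|[set~ f e]| <= 2 by rewrite cC.
exists 'I_3, (Graph ev ec); apply: (@framework_uniform_on _ _ _ _ 3) => //=.
- move=> e g _ _; rewrite -setCU -cards_eq0 cardsCs setCK card_ord cards2.
  by case: (f e != f g).
(* If [K] misses a vertex [w], an edge inside [K] must have color [w], so there are at most two; if
   [K] has at most one vertex, no edge fits. *)
- move=> K; have [K3|K3] := leqP 3 #|K|; first exact: leq_trans (geq_minl _ _) K3.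
  have /subsetPn[w _ wK] : ~~ ([set: 'I_3] \subset K).
    by apply/negP => /subset_leq_card; rewrite cardsT card_ord leqNgt K3.
  apply: leq_trans (geq_minr _ _) _.
  have [K2|K2] := leqP 2 #|K|.
    apply: leq_trans K2; apply: leq_trans (fP w); apply: subset_leq_card.
    apply/subsetP => e; rewrite !inE => /andP[-> /subsetP sK] /=.
    by apply: contraNT wK => fw; apply: sK; rewrite !inE eq_sym.
  rewrite (_ : [set e in _ | _] = set0) ?cards0 //.
  apply/setP => e; rewrite !inE; apply/negbTE/negP => /andP[_ /subset_leq_card].
  by rewrite cC leqNgt K2.
- move=> v; left; apply: leq_trans (_ : 3 <= 3) => //; apply: leq_trans (fP v).
  by apply/subset_leq_card/subsetP => e; rewrite !inE negbK eq_sym.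
Qed.

End Frameworks.

(** * No framework in rank three with at least seven elements *)

Section NotQuasiGraphic.
Variables (V T : finType) (H : graph V T) (N : matroid T).
Hypotheses (uN : uniform_on N 3) (cN : 7 <= #|ground N|) (fH : framework H N).

Let avoiding (v : V) : {set T} := [set e in eset H | v \notin ends H e].

Lemma delete_vertex_avoiding (v : V) : eset (delete_vertex H v) = avoiding v.
Proof. by apply/setP => e; rewrite !inE subsetC sub1set inE. Qed.

(** Three edges avoiding [v] would span [N], so (QG3) would force [e], which meets [v], to be a loop
    at [v]. *)
Lemma avoiding_le2 e (v z : V) : e \in eset H -> v != z ->
  ends H e = [set v; z] -> #|avoiding v| <= 2.
Proof.
move=> eH nvz ee; rewrite leqNgt; apply/negP => gt2.
have ve : v \in ends H e by rewrite ee set21.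
have vH : v \in vset H by apply: subsetP ve; apply: ends_vset.
have := QG3 fH vH; rewrite delete_vertex_avoiding.
rewrite (uniform_on_mclosure_large uN) //; last first.
  by rewrite -(QG1 fH); apply/subsetP => g; rewrite inE => /andP[].
rewrite -(QG1 fH) => /subsetP/(_ e eH); rewrite !inE eH ve /= ee => /eqP/setP/(_ z).
by rewrite !inE eqxx orbT eq_sym (negPf nvz).
Qed.

Lemma no_nonloop e : e \in eset H -> #|ends H e| != 2.
Proof.
move=> eH; apply/negP => /cards2P[u [v [nuv ee]]].
have ue : u \in ends H e by rewrite ee set21.
have ve : v \in ends H e by rewrite ee set22.
have uH : u \in vset H by apply: subsetP ue; apply: ends_vset.
have Au : #|avoiding u| <= 2 by apply: avoiding_le2 ee.
have Av : #|avoiding v| <= 2.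
  by apply: (@avoiding_le2 _ _ u eH); rewrite 1?eq_sym // setUC.
have cH : #|eset H| >= 7 by rewrite (QG1 fH).
(* At least [7 - 2 = 5] edges meet [u], so its component has rank 3, and (QG2) yields a third
   vertex. *)
have /subsetPn[w wK wuv] : ~~ (component H u \subset [set u; v]).
  apply/negP => /subset_leq_card; rewrite cards2 nuv => K2.
  have := QG2 fH (component_in uH); rewrite component_induced_vset.
  rewrite (uniform_on_rank uN); last first.
    by rewrite -(QG1 fH); apply/subsetP => g; rewrite inE => /andP[].
  have : #|eset H :\: avoiding u| <= #|eset (induced H (component H u))|.
    apply/subset_leq_card/subsetP => g; rewrite in_setD => /andP[+ gH].
    by rewrite inE gH /= negbK; apply: component_edge.
  have := cardsD (eset H) (avoiding u).
  have := subset_leq_card (subsetIr (eset H) (avoiding u)).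
  by lia.
move: wuv; rewrite !inE negb_or => /andP[nwu nwv].
have Aw : #|avoiding w| <= 2.
  move: wK; rewrite inE => /andP[_].
  rewrite (sym_connect_sym (adj_sym H)) => cwu.
  have [g [z [gH nwz eg]]] := connect_nonloop cwu nwu.
  exact: avoiding_le2 gH nwz eg.
(* An edge has at most two ends, so it misses one of the three vertices; hence at most [2 + 2 + 2]
   edges. *)
have : eset H \subset avoiding u :|: avoiding v :|: avoiding w.
  apply/subsetP => g gH; rewrite !inE gH /= -!negb_and; apply/negP.
  case/andP=> /andP[ug vg] wg.
  have : #|[set u; v; w]| <= #|ends H g|.
    by apply: subset_leq_card; rewrite !subUset !sub1set ug vg wg.
  have /andP[_] := ends_card gH.
  rewrite setUC cardsU1 cards2 nuv !inE negb_or nwu nwv.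
  by lia.
move/subset_leq_card.
have := (leq_card_setU (avoiding u :|: avoiding v) (avoiding w)).1.
have := (leq_card_setU (avoiding u) (avoiding v)).1.
by lia.
Qed.

Lemma all_loops e : e \in eset H -> exists v, ends H e = [set v].
Proof.
move=> eH; have := no_nonloop eH; have := ends_card eH => le2 n2.
by apply/cards1P/eqP; lia.
Qed.

Lemma rank3_not_framework : False.
Proof.
(* Stated for any [G], since it serves both [H] and the subgraph induced by a circuit. *)
have connE (G : graph V T) (x y : V) :
    (forall e, e \in eset G -> exists v, ends G e = [set v]) ->
    connect (adj G) x y -> x = y.
  move=> loopG cxy; apply/eqP; apply/negPn/negP => nxy.
  have [e [z [eG nxz ee]]] := connect_nonloop cxy nxy.
  have [v ev] := loopG e eG; move: nxz; rewrite ee in ev.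
  have := cards1 v; rewrite -ev cards2; by case: (x != z).
(* Two loops at one vertex would give a component with one vertex and rank at least 2, against
   (QG2). *)
have endsI : {in eset H &, injective (ends H)}.
  move=> e f eH fH' ef; apply/eqP/negPn/negP => nef.
  have [v ev] := all_loops eH.
  have ve : v \in ends H e by rewrite ev set11.
  have vH : v \in vset H by apply: subsetP ve; apply: ends_vset.
  have := QG2 fH (component_in vH); rewrite component_induced_vset.
  rewrite (uniform_on_rank uN); last first.
    by rewrite -(QG1 fH); apply/subsetP => g; rewrite inE => /andP[].
  have : #|[set e; f]| <= #|eset (induced H (component H v))|.
    by apply: subset_leq_card; rewrite subUset !sub1set !component_edge -?ef.
  have : #|component H v| <= 1.
    rewrite -(cards1 v); apply/subset_leq_card/subsetP => y; rewrite !inE.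
    by case/andP=> _ /(connE H v y all_loops) ->.
  by rewrite cards2 nef; lia.
(* Any four elements form a circuit; as loops at distinct vertices, their end sets are four distinct
   components. *)
have /card_geqP[s [us ss sN]] : 4 <= #|ground N| by lia.
pose C := [set x in s].
have sC : C \subset ground N by apply/subsetP => x; rewrite inE; apply: sN.
have cC : #|C| = 4 by rewrite cardsE (card_uniqP us).
have := QG4 fH (uniform_on_circuit uN sC cC).
apply/negP; rewrite -ltnNge; apply: (@leq_trans #|ends H @: C|).
  rewrite card_in_imset ?cC // => e f eC fC.
  by apply: endsI; rewrite (QG1 fH) (subsetP sC).
apply/subset_leq_card/subsetP => _ /imsetP[e eC ->].
have eH : e \in eset H by rewrite (QG1 fH) (subsetP sC).
have [v ev] := all_loops eH.
have vG : v \in vset (edge_induced H C).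
  by apply/bigcupP; exists e; rewrite ?inE ?eH ?ev ?set11 //; rewrite inE in eC.
suff -> : ends H e = component (edge_induced H C) v by apply: component_in.
apply/setP => y; rewrite ev inE inE.
apply/eqP/andP => [->|[_ cvy]]; first by rewrite connect0.
by symmetry; apply: connE cvy => g /setIP[gH _]; apply: all_loops.
Qed.

End NotQuasiGraphic.

Theorem theorem3p1 : excluded_minor quasi_graphic (uniform 3 7).
Proof.
split.
  case=> V [H fH]; apply: (rank3_not_framework _ _ fH).
    exact: uniform_uniform_on.
  by rewrite cardsT card_ord.
move=> N [C [D [sCD dCD nCD [gN iN]]]].
have sC : C \subset ground (uniform 3 7) by apply: subsetT.
have uN : uniform_on N (3 - #|C|).
  move=> I; rewrite iN gN.
  exact: (uniform_on_contract_delete (@uniform_uniform_on 3 7) D sC).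
(* Contracting anything lowers the rank to at most 2; otherwise [D] is nonempty and at most six
   elements remain. *)
case: (posnP #|C|) => [c0|c_gt0]; last first.
  have [c1|c1] := leqP #|C| 1; last first.
    by apply: uniform_on_le1_quasi_graphic uN; lia.
  have c2 : 3 - #|C| = 2 by lia.
  by rewrite c2 in uN; apply: uniform_on_2_quasi_graphic.
apply: uniform_on_3_quasi_graphic; last by rewrite c0 subn0 in uN.
rewrite gN /= setTD setDE -setCU cardsCs setCK card_ord.
by move: nCD; rewrite -card_gt0; case: #|_ :|: _| => // k _; apply: leq_subr.
Qed.
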